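(* Let $M\subset\mathbb{R}^{3,1}$ be a spacelike surface with a canonical normal null direction $Z$, where $Z$ is a unit spacelike parallel vector field on $\mathbb{R}^{3,1}$. If $M$ is minimal (i.e. $\vec H=0$ on $M$), then $M$ is flat and has flat normal bundle (i.e. $K=K_N=0$ on $M$).
   Context: $\mathbb{R}^{3,1}$ is $\mathbb{R}^4$ with the metric $\langle\cdot,\cdot\rangle=dx_1^2+dx_2^2+dx_3^2-dx_4^2$, oriented by the canonical basis. A smooth surface $M\subset\mathbb{R}^{3,1}$ is spacelike if the induced metric is Riemannian; then $\mathbb{R}^{3,1}=T_pM\oplus N_pM$ orthogonally at each $p\in M$. For a parallel (i.e. constant) vector field $Z$ on $\mathbb{R}^{3,1}$ write $Z=Z^\top+Z^\perp$ for its tangent and normal parts along $M$. $M$ has a canonical normal null direction with respect to $Z$ if $Z^\perp$ is a lightlike (nonzero, $\langle Z^\perp,Z^\perp\rangle=0$) normal vector field on $M$. Since $\langle Z,Z\rangle=1$, $|Z^\top|=1$. $B(X,Y)=\overline\nabla_XY-\nabla_XY$ is the second fundamental form, where $\overline\nabla$, $\nabla$ are the Levi-Civita connections of $\mathbb{R}^{3,1}$ and $M$; $A_\nu$ is defined by $\langle A_\nu X,Y\rangle=\langle B(X,Y),\nu\rangle$. The mean curvature vector is $\vec H=\frac12\mathrm{tr}_{\langle\cdot,\cdot\rangle}B$. $K$ is the Gauss curvature of the induced metric. $W$ is the unit tangent vector field orthogonal to $Z^\top$ with $(Z^\top,W)$ positively oriented, $W'$ is the lightlike normal field with $\langle Z^\perp,W'\rangle=1$,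 and the orientation of $M$ is such that $(Z^\top,W,e_3,e_4)$ with $e_3=\frac{Z^\perp+W'}{\sqrt2}$, $e_4=\frac{Z^\perp-W'}{\sqrt2}$ is a positively oriented orthonormal frame of $\mathbb{R}^{3,1}$. The normal curvature is $K_N=\langle(A_{e_3}A_{e_4}-A_{e_4}A_{e_3})(Z^\top),W\rangle$; the normal bundle is flat iff $K_N=0$. *)

(* Defs.v *)
From HB Require Import structures.
From mathcomp Require Import all_boot all_order all_algebra.
From mathcomp Require Import all_classical all_reals all_analysis.
From mathcomp Require Import ring lra.

Set Implicit Arguments.
Unset Strict Implicit.
Unset Printing Implicit Defensive.

Import Order.TTheory GRing.Theory Num.Theory.
Import numFieldNormedType.Exports.

Local Open Scope classical_set_scope.
Local Open Scope ring_scope.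

(** Vectors of R^{3,1} are row vectors; the coordinate of index 3 is timelike. *)
Definition mink {R : realType} (u v : 'rV[R]_4) : R :=
  \sum_(i < 4) (-1) ^+ (i == 3%N :> nat) * u 0 i * v 0 i.

Definition lightlike {R : realType} (v : 'rV[R]_4) : Prop :=
  v <> 0 /\ mink v v = 0.

Definition pd {R : realType} {V : normedModType R}
    (f : 'rV[R]_2 -> V) (i : 'I_2) : 'rV[R]_2 -> V :=
  fun q => 'D_(delta_mx 0 i) f q.

Definition iter_pd {R : realType} {V : normedModType R}
    (s : seq 'I_2) (f : 'rV[R]_2 -> V) : 'rV[R]_2 -> V :=
  foldr (fun i h => pd h i) f s.

(** C^oo on U: all iterated partial derivatives exist and are continuous *)
Definition smooth_on {R : realType} {V : normedModType R}
    (U : set 'rV[R]_2) (f : 'rV[R]_2 -> V) : Prop :=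
  forall (s : seq 'I_2) (q : 'rV[R]_2), U q ->
    {for q, continuous (iter_pd s f)} /\
    (forall i : 'I_2, derivable (iter_pd s f) q (delta_mx 0 i)).

(** The rows of [jac X q] are the coordinate vectors d_0 X, d_1 X, so a row
    vector [a] of coordinates represents the tangent vector [a *m jac X q]. *)
Definition jac {R : realType} (X : 'rV[R]_2 -> 'rV[R]_4) (q : 'rV[R]_2) :
  'M[R]_(2, 4) := \matrix_(i < 2) pd X i q.

(** A smooth injective immersion of the open set U which is a homeomorphism
    onto a relatively open subset of M (the last clause says that X maps open
    subsets of U to relatively open subsets of M). *)
Record local_param {R : realType} (M : set 'rV[R]_4)
    (U : set 'rV[R]_2) (X : 'rV[R]_2 -> 'rV[R]_4) : Prop := LocalParam {
  lp_open : open U;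
  lp_smooth : smooth_on U X;
  lp_immersion : forall q, U q -> row_free (jac X q);
  lp_inj : forall q q', U q -> U q' -> X q = X q' -> q = q';
  lp_homeo : forall U' : set 'rV[R]_2, open U' -> U' `<=` U ->
    exists V : set 'rV[R]_4, open V /\ X @` U' = M `&` V }.

Definition smooth_surface {R : realType} (M : set 'rV[R]_4) : Prop :=
  forall p, M p -> exists (U : set 'rV[R]_2) (X : 'rV[R]_2 -> 'rV[R]_4) (q : 'rV[R]_2),
    [/\ local_param M U X, U q & X q = p].

(** The pointwise properties [P X q] used below do not depend on the local
    parametrization X around the point X q of M. *)
Definition on_surface {R : realType} (M : set 'rV[R]_4)
    (P : ('rV[R]_2 -> 'rV[R]_4) -> 'rV[R]_2 -> Prop) : Prop :=
  forall U X q, local_param M U X -> U q -> P X q.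

(** Christoffel symbol Gamma^k_{ij} *)
Definition christoffel {R : realType} (g : 'rV[R]_2 -> 'M[R]_2)
    (k i j : 'I_2) (q : 'rV[R]_2) : R :=
  2^-1 * \sum_(l < 2) invmx (g q) k l *
    (pd (fun p => g p j l) i q + pd (fun p => g p i l) j q
     - pd (fun p => g p i j) l q).

(** Levi-Civita covariant derivative along the i-th coordinate field, of the
    vector field with coordinates y *)
Definition nabla {R : realType} (g : 'rV[R]_2 -> 'M[R]_2) (i : 'I_2)
    (y : 'rV[R]_2 -> 'rV[R]_2) : 'rV[R]_2 -> 'rV[R]_2 :=
  fun q => pd y i q + \row_k \sum_(j < 2) christoffel g k i j q * y q 0 j.

Definition coord_field {R : realType} (i : 'I_2) : 'rV[R]_2 -> 'rV[R]_2 :=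
  fun=> delta_mx 0 i.

(** R(d_0, d_1) y; there is no bracket term since [d_0, d_1] = 0 *)
Definition riemann {R : realType} (g : 'rV[R]_2 -> 'M[R]_2)
    (y : 'rV[R]_2 -> 'rV[R]_2) (q : 'rV[R]_2) : 'rV[R]_2 :=
  nabla g 0 (nabla g 1 y) q - nabla g 1 (nabla g 0 y) q.

(** K = <R(d_0, d_1) d_1, d_0> / (<d_0, d_0> <d_1, d_1> - <d_0, d_1>^2) *)
Definition gauss_curvature {R : realType} (g : 'rV[R]_2 -> 'M[R]_2)
    (q : 'rV[R]_2) : R :=
  (riemann g (coord_field 1) q *m g q) 0 0 / \det (g q).

Definition induced_metric {R : realType} (X : 'rV[R]_2 -> 'rV[R]_4)
    (q : 'rV[R]_2) : 'M[R]_2 :=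
  \matrix_(i, j) mink (pd X i q) (pd X j q).

Definition spacelike_at {R : realType} (X : 'rV[R]_2 -> 'rV[R]_4)
    (q : 'rV[R]_2) : Prop :=
  forall a : 'rV[R]_2, a != 0 -> 0 < mink (a *m jac X q) (a *m jac X q).

Definition is_normal {R : realType} (X : 'rV[R]_2 -> 'rV[R]_4)
    (q : 'rV[R]_2) (v : 'rV[R]_4) : Prop :=
  forall a : 'rV[R]_2, mink v (a *m jac X q) = 0.

(** Coordinates of the tangent part of v; see [normal_partP] *)
Definition tan_coord {R : realType} (X : 'rV[R]_2 -> 'rV[R]_4)
    (q : 'rV[R]_2) (v : 'rV[R]_4) : 'rV[R]_2 :=
  (\row_i mink v (pd X i q)) *m invmx (induced_metric X q).

Definition tan_part {R : realType} (X : 'rV[R]_2 -> 'rV[R]_4)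
    (q : 'rV[R]_2) (v : 'rV[R]_4) : 'rV[R]_4 := tan_coord X q v *m jac X q.

Definition normal_part {R : realType} (X : 'rV[R]_2 -> 'rV[R]_4)
    (q : 'rV[R]_2) (v : 'rV[R]_4) : 'rV[R]_4 := v - tan_part X q v.

(** B(d_i, d_j): the ambient derivative of the field d_j X along d_i X minus
    the Levi-Civita derivative of the induced metric *)
Definition sff_coord {R : realType} (X : 'rV[R]_2 -> 'rV[R]_4)
    (q : 'rV[R]_2) (i j : 'I_2) : 'rV[R]_4 :=
  pd (pd X j) i q - nabla (induced_metric X) i (coord_field j) q *m jac X q.

Definition second_ff {R : realType} (X : 'rV[R]_2 -> 'rV[R]_4)
    (q a b : 'rV[R]_2) : 'rV[R]_4 :=
  \sum_(i < 2) \sum_(j < 2) (a 0 i * b 0 j) *: sff_coord X q i j.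

Definition mean_curvature_vector {R : realType} (X : 'rV[R]_2 -> 'rV[R]_4)
    (q : 'rV[R]_2) : 'rV[R]_4 :=
  2^-1 *: \sum_(i < 2) \sum_(j < 2)
    invmx (induced_metric X q) i j *: sff_coord X q i j.

(** A_nu, acting on coordinates of tangent vectors; see [shape_opP] *)
Definition shape_op {R : realType} (X : 'rV[R]_2 -> 'rV[R]_4)
    (q : 'rV[R]_2) (nu : 'rV[R]_4) (a : 'rV[R]_2) : 'rV[R]_2 :=
  (\row_j mink (second_ff X q a (delta_mx 0 j)) nu)
    *m invmx (induced_metric X q).

Definition frame3 {R : realType} (n w' : 'rV[R]_4) : 'rV[R]_4 :=
  (Num.sqrt 2)^-1 *: (n + w').
Definition frame4 {R : realType} (n w' : 'rV[R]_4) : 'rV[R]_4 :=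
  (Num.sqrt 2)^-1 *: (n - w').

(** [w] is the coordinate vector of W and [w'] is W'. The orientation of M is
    the one for which (Z^T, W) is positive, so it is encoded by the sign of W,
    which [af_oriented] fixes. *)
Record adapted_frame {R : realType} (X : 'rV[R]_2 -> 'rV[R]_4)
    (q : 'rV[R]_2) (Z : 'rV[R]_4) (w : 'rV[R]_2) (w' : 'rV[R]_4) : Prop :=
  AdaptedFrame {
  af_unit : mink (w *m jac X q) (w *m jac X q) = 1;
  af_orth : mink (tan_part X q Z) (w *m jac X q) = 0;
  af_normal : is_normal X q w';
  af_null : lightlike w';
  af_dual : mink (normal_part X q Z) w' = 1;
  af_oriented :
    0 < \det (\matrix_(i < 4) nth 0
      [:: tan_part X q Z; w *m jac X q;
          frame3 (normal_part X q Z) w'; frame4 (normal_part X q Z) w'] i) }.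

(** K_N = <(A_e3 A_e4 - A_e4 A_e3) Z^T, W> *)
Definition normal_curvature {R : realType} (X : 'rV[R]_2 -> 'rV[R]_4)
    (q : 'rV[R]_2) (Z : 'rV[R]_4) (w : 'rV[R]_2) (w' : 'rV[R]_4) : R :=
  let A3 := shape_op X q (frame3 (normal_part X q Z) w') in
  let A4 := shape_op X q (frame4 (normal_part X q Z) w') in
  let z := tan_coord X q Z in
  mink ((A3 (A4 z) - A4 (A3 z)) *m jac X q) (w *m jac X q).

Definition spacelike {R : realType} (M : set 'rV[R]_4) : Prop :=
  on_surface M spacelike_at.

Definition canonical_normal_null_direction {R : realType}
    (M : set 'rV[R]_4) (Z : 'rV[R]_4) : Prop :=
  on_surface M (fun X q => lightlike (normal_part X q Z)).

Definition minimal {R : realType} (M : set 'rV[R]_4) : Prop :=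
  on_surface M (fun X q => mean_curvature_vector X q = 0).

Definition flat {R : realType} (M : set 'rV[R]_4) : Prop :=
  on_surface M (fun X q => gauss_curvature (induced_metric X) q = 0).

(** [adapted_frame_exists] below shows that there is a frame to quantify over *)
Definition flat_normal_bundle {R : realType}
    (M : set 'rV[R]_4) (Z : 'rV[R]_4) : Prop :=
  on_surface M (fun X q => forall w w', adapted_frame X q Z w w' ->
    normal_curvature X q Z w w' = 0).

Definition mink_mx {R : realType} : 'M[R]_4 :=
  diag_mx (\row_i (-1) ^+ (i == 3%N :> nat)).

Lemma minkE {R : realType} (u v : 'rV[R]_4) :
  mink u v = (u *m mink_mx *m v^T) 0 0.
Proof.
rewrite /mink mxE; apply: eq_bigr => i _.
by rewrite mul_mx_diag !mxE [u 0 i * _]mulrC.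
Qed.

Lemma minkC {R : realType} (u v : 'rV[R]_4) : mink u v = mink v u.
Proof. by apply: eq_bigr => i _; rewrite mulrAC. Qed.

Lemma minkDl {R : realType} (u v w : 'rV[R]_4) :
  mink (u + v) w = mink u w + mink v w.
Proof. by rewrite !minkE !mulmxDl mxE. Qed.

Lemma minkZl {R : realType} (c : R) (u w : 'rV[R]_4) :
  mink (c *: u) w = c * mink u w.
Proof. by rewrite !minkE -!scalemxAl mxE. Qed.

Lemma minkNl {R : realType} (u w : 'rV[R]_4) : mink (- u) w = - mink u w.
Proof. by rewrite -scaleN1r minkZl mulN1r. Qed.

Lemma minkDr {R : realType} (u v w : 'rV[R]_4) :
  mink w (u + v) = mink w u + mink w v.
Proof. by rewrite minkC minkDl !(minkC w). Qed.

Lemma minkZr {R : realType} (c : R) (u w : 'rV[R]_4) :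
  mink w (c *: u) = c * mink w u.
Proof. by rewrite minkC minkZl minkC. Qed.

Lemma minkNr {R : realType} (u w : 'rV[R]_4) : mink w (- u) = - mink w u.
Proof. by rewrite minkC minkNl minkC. Qed.

Lemma mink_suml {R : realType} (I : finType) (F : I -> 'rV[R]_4) w :
  mink (\sum_i F i) w = \sum_i mink (F i) w.
Proof.
apply: (big_morph (fun u => mink u w)) => [u v|]; first exact: minkDl.
by rewrite -(scale0r 0) minkZl mul0r.
Qed.

Lemma mink_tanr {R : realType} (X : 'rV[R]_2 -> 'rV[R]_4) q v (b : 'rV[R]_2) :
  mink v (b *m jac X q) = ((\row_i mink v (pd X i q)) *m b^T) 0 0.
Proof.
rewrite mulmx_sum_row minkC mink_suml mxE; apply: eq_bigr => i _.
by rewrite minkZl rowK !mxE mulrC minkC.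
Qed.

Lemma mink_tan {R : realType} (X : 'rV[R]_2 -> 'rV[R]_4) q (a b : 'rV[R]_2) :
  mink (a *m jac X q) (b *m jac X q) = (a *m induced_metric X q *m b^T) 0 0.
Proof.
rewrite mink_tanr; congr ((_ *m _) 0 0); apply/rowP => i; rewrite !mxE.
rewrite mulmx_sum_row mink_suml; apply: eq_bigr => j _.
by rewrite minkZl rowK mxE.
Qed.

Lemma induced_metric_unit {R : realType} (X : 'rV[R]_2 -> 'rV[R]_4) q :
  spacelike_at X q -> induced_metric X q \in unitmx.
Proof.
move=> sp; rewrite unitmxE unitfE; apply/negP => /det0P[a a0 ag].
by have := sp a a0; rewrite mink_tan ag mul0mx mxE ltxx.
Qed.

Lemma normal_partP {R : realType} (X : 'rV[R]_2 -> 'rV[R]_4) q v :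
  spacelike_at X q -> is_normal X q (normal_part X q v).
Proof.
move=> sp a; rewrite minkDl minkNl mink_tan mulmxKV ?induced_metric_unit//.
by rewrite -mink_tanr subrr.
Qed.

Lemma shape_opP {R : realType} (X : 'rV[R]_2 -> 'rV[R]_4) q nu a b :
  spacelike_at X q ->
  mink (shape_op X q nu a *m jac X q) (b *m jac X q)
  = mink (second_ff X q a b) nu.
Proof.
move=> sp; rewrite mink_tan mulmxKV ?induced_metric_unit// mxE.
have -> : second_ff X q a b =
    \sum_j b 0 j *: second_ff X q a (delta_mx 0 j).
  rewrite /second_ff exchange_big/=; apply: eq_bigr => j _.
  rewrite scaler_sumr; apply: eq_bigr => i _.
  rewrite (bigD1 j)//= big1 ?addr0 => [|k kj].
    by rewrite mxE !eqxx mulr1 scalerA [b 0 j * _]mulrC.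
  by rewrite mxE (negPf kj) andbF mulr0 scale0r.
rewrite mink_suml; apply: eq_bigr => j _.
by rewrite !mxE minkZl mulrC.
Qed.

Lemma adapted_frame_exists {R : realType} (X : 'rV[R]_2 -> 'rV[R]_4) q Z :
  spacelike_at X q -> mink Z Z = 1 -> lightlike (normal_part X q Z) ->
  exists w w', adapted_frame X q Z w w'.
Proof.
move=> sp Z1 [n0 nn].
have gU := induced_metric_unit sp; set g := induced_metric X q in gU.
have nN := normal_partP Z sp.
have Zdec : Z = normal_part X q Z + tan_part X q Z by rewrite subrK.
have tE : tan_part X q Z = tan_coord X q Z *m jac X q by [].
suff [w [w' wP]] : exists w w',
    [/\ [/\ mink (w *m jac X q) (w *m jac X q) = 1,
            mink (tan_part X q Z) (w *m jac X q) = 0,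
            is_normal X q w', mink w' w' = 0 & mink (normal_part X q Z) w' = 1]
      & 0 < \det (\matrix_(i < 4) nth 0
      [:: tan_part X q Z; w *m jac X q;
          frame3 (normal_part X q Z) w'; frame4 (normal_part X q Z) w'] i)].
  case: wP => -[? ? ? ? nw'] ?; exists w, w'; split => //; split => // w0.
  move: nw'; rewrite w0 -(scale0r 0) minkZr mul0r => /esym/eqP.
  by rewrite oner_eq0.
move: n0 nn nN Zdec tE.
move: (normal_part X q Z) (tan_part X q Z) (tan_coord X q Z).
move=> n t z n0 nn nN Zdec tE.
have tt : mink t t = 1.
  move: Z1; rewrite Zdec !(minkDl, minkDr) nn tE [mink (_ *m _) n]minkC nN.
  by rewrite !add0r.
have [w [ww tw]] : exists w, mink (w *m jac X q) (w *m jac X q) = 1 /\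
    mink t (w *m jac X q) = 0.
  pose c := z *m g.
  pose b : 'rV[R]_2 := \row_i (if i == 0 then - c 0 1 else c 0 0).
  have b0 : b != 0.
    apply/negP => /eqP/rowP b0; have c0 : c = 0.
      have c0 : c 0 0 = 0 by have := b0 1; rewrite [RHS]mxE mxE.
      have c1 : c 0 1 = 0.
        by have /eqP := b0 0; rewrite !mxE /= oppr_eq0 => /eqP.
      apply/rowP => -[[|[|//]] lti]; rewrite [RHS]mxE.
        by rewrite -[RHS]c0; congr (c 0 _); apply/val_inj.
      by rewrite -[RHS]c1; congr (c 0 _); apply/val_inj.
    move: tt; rewrite tE mink_tan -/g -/c c0 mul0mx mxE => /esym/eqP.
    by rewrite oner_eq0.
  have bb := sp b b0; set s := mink _ _ in bb.
  exists ((Num.sqrt s)^-1 *: b); rewrite -scalemxAl; split.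
    rewrite minkZl minkZr -/s mulrA -expr2 exprVn sqr_sqrtr ?ltW//.
    by rewrite mulVf// gt_eqF.
  rewrite minkZr tE mink_tan -/g -/c mxE !big_ord_recl big_ord0.
  have -> : lift 0 0 = 1 :> 'I_2 by apply/val_inj.
  have -> : b^T 0 0 = - c 0 1 by rewrite 2!mxE.
  have -> : b^T 1 0 = c 0 0 by rewrite 2!mxE.
  by rewrite addr0 mulrN [c 0 1 * _]mulrC addNr mulr0.
have [w' [w'N w'w' nw']] : exists w',
    [/\ is_normal X q w', mink w' w' = 0 & mink n w' = 1].
  have [u un] : exists u, mink n u != 0.
    have [i ni] : exists i, n 0 i != 0.
      apply/existsP; apply: contra_notT n0 => /existsPn h.
      by apply/rowP => i; rewrite mxE; apply/eqP; have := h i; rewrite negbK.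
    exists (delta_mx 0 i); rewrite /mink (bigD1 i)//= big1 => [|j ji].
      by rewrite mxE !eqxx addr0 mulr1 mulf_neq0// signr_eq0.
    by rewrite [delta_mx _ _ _ _]mxE (negPf ji) andbF mulr0.
  have vN := normal_partP u sp.
  have nv : mink n (normal_part X q u) = mink n u.
    by rewrite minkDr minkNr nN oppr0 addr0.
  move: (normal_part X q u) vN nv => v vN nv; move: (mink n u) un nv => c c0 nv.
  exists (c^-1 *: (v - (mink v v / (c *+ 2)) *: n)); split.
  - move=> a; rewrite minkZl minkDl minkNl minkZl nN vN.
    by rewrite mulr0 oppr0 addr0 mulr0.
  - rewrite !(minkZl, minkZr, minkDl, minkDr, minkNl, minkNr).
    by rewrite [mink v n]minkC nv nn; field.
  - rewrite !(minkZr, minkDr, minkNr) nv nn mulr0 oppr0 addr0.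
    by rewrite mulVf.
pose F x := \matrix_(i < 4) nth 0 [:: t; x *m jac X q; frame3 n w'; frame4 n w'] i.
have det0 : \det (F w) != 0.
  have FF : F w *m mink_mx *m (F w)^T = mink_mx.
    have s2 : (Num.sqrt 2)^-1 * ((Num.sqrt 2)^-1 * 2) = 1 :> R.
      by rewrite mulrA -expr2 exprVn sqr_sqrtr// mulVf// pnatr_eq0.
    have m3 a : mink (frame3 n w') (a *m jac X q) = 0.
      by rewrite minkZl minkDl nN w'N addr0 mulr0.
    have m4 a : mink (frame4 n w') (a *m jac X q) = 0.
      by rewrite minkZl minkDl minkNl nN w'N oppr0 addr0 mulr0.
    have m33 : mink (frame3 n w') (frame3 n w') = 1.
      rewrite !(minkZl, minkZr, minkDl, minkDr) nn w'w' [mink w' n]minkC nw'.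
      by rewrite -[RHS]s2; ring.
    have m44 : mink (frame4 n w') (frame4 n w') = -1.
      rewrite !(minkZl, minkZr, minkDl, minkDr, minkNl, minkNr) nn w'w'.
      by rewrite [mink w' n]minkC nw' -[in RHS]s2; ring.
    have m34 : mink (frame3 n w') (frame4 n w') = 0.
      rewrite !(minkZl, minkZr, minkDl, minkDr, minkNl, minkNr) nn w'w'.
      by rewrite [mink w' n]minkC nw'; ring.
    have FE i j : (F w *m mink_mx *m (F w)^T) i j
        = mink (row i (F w)) (row j (F w)).
      rewrite minkE -row_mul !mxE; apply: eq_bigr => k _.
      by rewrite [row _ _ _ _]mxE !mxE.
    apply/matrixP => i j; rewrite FE !rowK !mxE.
    case: i j => [[|[|[|[|//]]]] i4] [[|[|[|[|//]]]] j4] /=;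
      rewrite ?tt ?ww ?tw ?m33 ?m44 ?m34 ?tE ?m3 ?m4 //;
      by rewrite minkC ?m3 ?m4 ?m34 -?tE.
  have := congr1 determinant FF; rewrite !det_mulmx det_tr => FF'.
  apply/eqP => F0; move: FF'; rewrite F0 mulr0 det_diag => /esym/eqP.
  by apply/negP/prodf_neq0 => i _; rewrite mxE signr_eq0.
have [Fpos|Fneg] := ltP 0 (\det (F w)); first by exists w, w'.
exists (- w), w'; split.
  by rewrite mulNmx !(minkNl, minkNr) opprK ww tw oppr0.
suff -> : \det (F (- w)) = - \det (F w) by rewrite oppr_gt0 lt_neqAle det0.
rewrite (@determinant_multilinear _ _ (F (- w)) (F w) (F w) 1 (-1) 0).
- by rewrite mulN1r mul0r addr0.
- by rewrite scale0r addr0 !rowK /= mulNmx scaleN1r.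
- by apply/matrixP => -[[|[|[|[|//]]]] i4] j; rewrite !mxE.
- by apply/matrixP => -[[|[|[|[|//]]]] i4] j; rewrite !mxE.
Qed.

(* Main.v *)
Require Import Defs.
From mathcomp Require Import all_boot all_order all_algebra.
From mathcomp Require Import all_classical all_reals all_analysis.
From mathcomp Require Import ring.

Set Implicit Arguments.
Unset Strict Implicit.
Unset Printing Implicit Defensive.

Import Order.TTheory GRing.Theory Num.Theory.
Import numFieldNormedType.Exports.

Local Open Scope classical_set_scope.
Local Open Scope ring_scope.

(** Write [Z = T + N] along the surface, with [T] tangent and [N] normal. Since
    [N] is null everywhere, differentiating [<N, N> = 0] along [d_k] gives
    [<d_k N, N> = 0]. As [Z] is constant, [d_k N = - d_k T], and the normal part
    of [d_k T] is [B(d_k, T)], so [<B(d_k, T), N> = 0]: the symmetric form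
    [h = <B, N>] has [T] in its kernel ([sff_tan_coord_null]). Minimality makes
    [h] traceless. A symmetric form on a Euclidean plane with a unit vector in
    its kernel and trace zero vanishes ([traceless_degenerate_eq0]), so [h = 0].

    The normal plane is Lorentzian, so a normal vector orthogonal to the null
    vector [N] is a multiple of [N] ([normal_orth_null]). Thus every [B(X, Y)] is
    a multiple of [N], all the products [<B(X, Y), B(X', Y')>] vanish, and the
    Gauss equation ([gauss_equation]) gives [K = 0]. Moreover [<B, N> = 0] makes
    the shape operators of [e_3 = (N + W') / sqrt 2] and
    [e_4 = (N - W') / sqrt 2] opposite to each other, hence they commute and
    [K_N = 0] ([normal_curvature_eq0]).

    The bridge between the intrinsic definition of the curvature, by Christoffel
    symbols, and the ambient derivatives of the parametrization is that the
    Levi-Civita derivative of a tangent field is the tangent part of its ambient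
    derivative ([nabla_tan]). Both this fact and the Gauss equation rest on the
    equality of mixed partial derivatives ([schwarz], [pdC]). *)

(** * Symmetry of mixed derivatives *)

Lemma is_derive_line (R : realType) (V W : normedModType R) (f : V -> W)
    (u p : V) (t : R) : derivable f (t *: u + p) u ->
  is_derive t 1 (fun s => f (s *: u + p)) ('D_u f (t *: u + p)).
Proof.
have E : (fun h : R => h^-1 *: (f ((h *: 1 + t) *: u + p) - f (t *: u + p)))
    = (fun h => h^-1 *: (f (h *: u + (t *: u + p)) - f (t *: u + p))).
  by apply/funext => h; rewrite [h *: 1]mulr1 scalerDl addrA.
move=> df; apply: DeriveDef; first by rewrite /derivable E.
by rewrite /derive E.
Qed.

(** The mean value theorem along [u], applied to the increment of [f] in the
    direction [v], followed by the mean value theorem along [v] for ['D_u f]. *)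
Lemma second_difference (R : realType) (V : normedModType R) (f : V -> R)
    (u v q : V) (h : R) (A : set V) : 0 < h ->
  (forall s t, 0 <= s <= h -> 0 <= t <= h -> A (s *: u + (t *: v + q))) ->
  (forall p, A p -> derivable f p u /\ derivable ('D_u f) p v) ->
  exists p, A p /\
    f (h *: u + (h *: v + q)) - f (h *: u + q) - (f (h *: v + q) - f q)
      = 'D_v ('D_u f) p * h * h.
Proof.
move=> h0 sA dA.
have fu t s : 0 <= s <= h -> 0 <= t <= h ->
    is_derive s 1 (fun s => f (s *: u + (t *: v + q)))
      ('D_u f (s *: u + (t *: v + q))).
  by move=> sh th; apply: is_derive_line; apply: (dA _ (sA _ _ sh th)).1.
have hh : 0 <= h <= h by rewrite (ltW h0) lexx.
have h00 : (0 : R) <= 0 <= h by rewrite (ltW h0) lexx.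
have itvW (x : R) : x \in `]0, h[ -> 0 <= x <= h.
  by rewrite in_itv/= => /andP[/ltW-> /ltW->].
pose F s := f (s *: u + (h *: v + q)) - f (s *: u + (0 *: v + q)).
have dF s : 0 <= s <= h -> is_derive s 1 F
    ('D_u f (s *: u + (h *: v + q)) - 'D_u f (s *: u + (0 *: v + q))).
  by move=> sh; apply: is_deriveB; apply: fu.
have cF : {within `[0, h], continuous F}.
  apply: derivable_within_continuous => s; rewrite in_itv/= => sh.
  by case: (dF s sh).
have [s] := MVT h0 (fun s hs => dF s (itvW s hs)) cF.
rewrite in_itv/= subr0 => /andP[/ltW s0 /ltW sh] FE.
have {s0 sh} sh : 0 <= s <= h by rewrite s0.
pose G t := 'D_u f (s *: u + (t *: v + q)).
have GE : G = fun t => 'D_u f (t *: v + (s *: u + q)).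
  by apply/funext => t; rewrite /G addrCA.
have dG t : 0 <= t <= h ->
    is_derive t 1 G ('D_v ('D_u f) (t *: v + (s *: u + q))).
  move=> th; rewrite GE; apply: is_derive_line.
  by rewrite addrCA; apply: (dA _ (sA _ _ sh th)).2.
have cG : {within `[0, h], continuous G}.
  apply: derivable_within_continuous => t; rewrite in_itv/= => th.
  by case: (dG t th).
have [t] := MVT h0 (fun t ht => dG t (itvW t ht)) cG.
rewrite in_itv/= subr0 => /andP[/ltW t0 /ltW th] GGE.
exists (s *: u + (t *: v + q)); split; first by apply: sA; rewrite ?t0.
rewrite [s *: u + _]addrCA -GGE /G -FE /F !scale0r !add0r.
by ring.
Qed.

(** The second difference of [f] is symmetric in [u] and [v], so each mixed
    derivative takes, at some point close to [q], the same value as the other one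
    at another point close to [q]; conclude by continuity at [q]. *)
Lemma schwarz (R : realType) (V : normedModType R) (f : V -> R) (u v q : V) :
  (\forall p \near q, [/\ derivable f p u, derivable f p v,
    derivable ('D_u f) p v & derivable ('D_v f) p u]) ->
  {for q, continuous ('D_v ('D_u f))} -> {for q, continuous ('D_u ('D_v f))} ->
  'D_v ('D_u f) q = 'D_u ('D_v f) q.
Proof.
have tri (a b c e : R) : `|b - a| < e / 2 -> `|c - a| < e / 2 -> `|b - c| <= e.
  move=> ba ca; rewrite -(subrKA a) (le_trans (ler_normD _ _))// [leRHS]splitr.
  by rewrite lerD ?(ltW ba)// distrC ltW.
move=> df cvu cuv; apply/eqP; rewrite -subr_eq0 -normr_le0.
apply/ler_addgt0Pl => e e0; rewrite addr0.
have e2 : 0 < e / 2 by rewrite divr_gt0.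
have /nbhs_ballP[d /= d0 dP] : \forall p \near q,
    [/\ [/\ derivable f p u, derivable f p v, derivable ('D_u f) p v &
        derivable ('D_v f) p u],
      `|'D_v ('D_u f) q - 'D_v ('D_u f) p| < e / 2 &
      `|'D_u ('D_v f) q - 'D_u ('D_v f) p| < e / 2].
  move/cvgrPdist_lt/(_ _ e2): cvu => nu; move/cvgrPdist_lt/(_ _ e2): cuv => nv.
  by move: df nu nv; apply: filterS3 => p; apply: And3.
pose h := d / 2 / (`|u| + `|v| + 1).
have m0 : 0 < `|u| + `|v| + 1 by rewrite ltr_wpDl// addr_ge0.
have h0 : 0 < h by rewrite !divr_gt0.
(* [h] is small enough for the parallelogram on [h *: u], [h *: v] to fit. *)
have inA s t : 0 <= s <= h -> 0 <= t <= h -> ball q d (s *: u + (t *: v + q)).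
  move=> /andP[s0 sh] /andP[t0 th]; rewrite -ball_normE /ball_ /= addrA opprD.
  rewrite addrCA subrr addr0 normrN (le_lt_trans (ler_normD _ _))//.
  rewrite !normrZ !ger0_norm// (@le_lt_trans _ _ (d / 2))//; last first.
    by rewrite gtr_pMr// invf_lt1// ltr1n.
  have -> : d / 2 = h * (`|u| + `|v| + 1) by rewrite divfK// gt_eqF.
  rewrite !mulrDr -[leLHS]addr0 mulr1.
  by rewrite lerD ?(ltW h0)// lerD// ler_wpM2r.
have [p [/dP[_ pq _] pE]] := @second_difference _ _ f u v q h (ball q d) h0 inA
  (fun p pA => let: And3 (And4 a _ c _) _ _ := dP p pA in conj a c).
have inA' s t : 0 <= s <= h -> 0 <= t <= h -> ball q d (s *: v + (t *: u + q)).
  by move=> sh th; rewrite addrCA; apply: inA.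
have [p' [/dP[_ _ p'q] p'E]] := @second_difference _ _ f v u q h (ball q d) h0
  inA' (fun p pA => let: And3 (And4 _ b _ d) _ _ := dP p pA in conj b d).
have pp' : 'D_v ('D_u f) p = 'D_u ('D_v f) p'.
  move: pE p'E; rewrite [h *: v + (h *: u + q)]addrCA.
  move: ('D_v ('D_u f) p) ('D_u ('D_v f) p') => a b.
  move: (f _) (f _) (f _) (f _) => x y z w xE yE.
  have h0' : h != 0 by rewrite gt_eqF.
  by apply: (mulIf h0'); apply: (mulIf h0'); rewrite -xE -yE; ring.
move: pq p'q; rewrite pp'; exact: tri.
Qed.

(** Regularity is asked on an open set because the coordinates of ['D_w f] have to
    be recognized as derivatives of the coordinates of [f] near each point where
    a second derivative is taken. *)
Lemma schwarz_matrix (R : realType) (V : normedModType R) m n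
    (f : V -> 'M[R]_(m.+1, n.+1)) (A : set V) (u v q : V) : open A -> A q ->
  (forall p, A p -> [/\ derivable f p u, derivable f p v,
    derivable ('D_u f) p v & derivable ('D_v f) p u]) ->
  {for q, continuous ('D_v ('D_u f))} -> {for q, continuous ('D_u ('D_v f))} ->
  'D_v ('D_u f) q = 'D_u ('D_v f) q.
Proof.
move=> oA Aq df cvu cuv.
have nearA p : A p -> \forall x \near p, A x by move=> Ap; exact: open_nbhs_nbhs.
pose fc i j (p : V) : R := f p i j.
have D1 w i j p : derivable f p w -> 'D_w (fc i j) p = 'D_w f p i j.
  by move=> dfp; rewrite derive_mx// mxE.
have D2 w x i j p : (forall p, A p -> derivable f p w) ->
    derivable ('D_w f) p x -> A p ->
    derivable ('D_w (fc i j)) p x /\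
    'D_x ('D_w (fc i j)) p = 'D_x ('D_w f) p i j.
  move=> dw dwx Ap.
  have e : \forall y \near p, 'D_w f y i j = 'D_w (fc i j) y.
    by apply: filterS (nearA _ Ap) => y Ay; exact: (esym (D1 w i j y (dw y Ay))).
  split.
    by apply: near_eq_derivable e _; exact: ((derivable_mxP _ _ _).1 dwx).
  by rewrite -(near_eq_derive _ e) [in RHS]derive_mx// mxE.
have du p : A p -> derivable f p u by move=> /df[].
have dv p : A p -> derivable f p v by move=> /df[].
have duv p : A p -> derivable ('D_u f) p v by move=> /df[].
have dvu p : A p -> derivable ('D_v f) p u by move=> /df[].
have cont w x i j : (forall p, A p -> derivable f p w) ->
    (forall p, A p -> derivable ('D_w f) p x) ->
    {for q, continuous ('D_x ('D_w f))} ->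
    {for q, continuous ('D_x ('D_w (fc i j)))}.
  move=> dw dwx c.
  rewrite /prop_for /continuous_at (D2 _ _ _ _ _ dw (dwx _ Aq) Aq).2.
  apply: (@cvg_trans _ ('D_x ('D_w f) p i j @[p --> q])).
    apply: near_eq_cvg; apply: filterS (nearA _ Aq) => y Ay.
    by rewrite (D2 _ _ _ _ _ dw (dwx _ Ay) Ay).2.
  exact: (cvg_comp _ _ c (@coord_continuous _ _ _ i j _)).
apply/matrixP => i j.
transitivity ('D_v ('D_u (fc i j)) q).
  exact: (esym (D2 u v i j q du (duv _ Aq) Aq).2).
transitivity ('D_u ('D_v (fc i j)) q); last first.
  exact: (D2 v u i j q dv (dvu _ Aq) Aq).2.
apply: schwarz; [|exact: (cont u v i j du duv cvu)
  |exact: (cont v u i j dv dvu cuv)].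
apply: filterS (nearA _ Aq) => p Ap; apply: And4.
- exact: (derivable_mxP _ _ _).1 (du _ Ap) i j.
- exact: (derivable_mxP _ _ _).1 (dv _ Ap) i j.
- exact: (D2 _ _ _ _ _ du (duv _ Ap) Ap).1.
- exact: (D2 _ _ _ _ _ dv (dvu _ Ap) Ap).1.
Qed.

(** * Derivatives of products and inverses of matrices *)

Lemma is_derive_coord (R : realType) (V : normedModType R) m n
    (F : V -> 'M[R]_(m.+1, n.+1)) (dF : 'M[R]_(m.+1, n.+1)) q v i j :
  is_derive q v F dF -> is_derive q v (fun p => F p i j) (dF i j).
Proof.
move=> [dFq <-]; apply: DeriveDef; first exact: (derivable_mxP _ _ _).1.
by rewrite derive_mx// mxE.
Qed.

Lemma is_derive_matrix (R : realType) (V : normedModType R) m n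
    (F : V -> 'M[R]_(m.+1, n.+1)) (dF : 'M[R]_(m.+1, n.+1)) q v :
  (forall i j, is_derive q v (fun p => F p i j) (dF i j)) -> is_derive q v F dF.
Proof.
move=> dFij; have dFq : derivable F q v.
  by apply/derivable_mxP => i j; case: (dFij i j).
apply: DeriveDef => //; rewrite derive_mx//.
by apply/matrixP => i j; rewrite mxE; case: (dFij i j).
Qed.

Lemma is_derive_bigsum (R : realType) (V : normedModType R) n
    (F : 'I_n -> V -> R) (dF : 'I_n -> R) q v :
  (forall i, is_derive q v (F i) (dF i)) ->
  is_derive q v (fun p => \sum_i F i p) (\sum_i dF i).
Proof.
move=> dFi; have -> : (fun p => \sum_i F i p) = \sum_i F i.
  by apply/funext => p; rewrite fct_sumE.
exact: is_derive_sum.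
Qed.

Lemma is_derive_mulmx (R : realType) (V : normedModType R) m n r
    (F : V -> 'M[R]_(m.+1, n.+1)) (G : V -> 'M[R]_(n.+1, r.+1)) dF dG q v :
  is_derive q v F dF -> is_derive q v G dG ->
  is_derive q v (fun p => F p *m G p) (dF *m G q + F q *m dG).
Proof.
move=> FP GP; apply: is_derive_matrix => i k.
have -> : (fun p => (F p *m G p) i k) = fun p => \sum_j F p i j * G p j k.
  by apply/funext => p; rewrite mxE.
apply: is_derive_eq.
  apply: is_derive_bigsum => j; apply: is_deriveM; exact: is_derive_coord.
rewrite !mxE -big_split; apply: eq_bigr => j _ /=.
by rewrite addrC; congr (_ + _); rewrite mulrC.
Qed.

Lemma is_derive_mink (R : realType) (V : normedModType R)
    (F G : V -> 'rV[R]_4) dF dG q v :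
  is_derive q v F dF -> is_derive q v G dG ->
  is_derive q v (fun p => mink (F p) (G p)) (mink dF (G q) + mink (F q) dG).
Proof.
move=> FP GP; apply: is_derive_eq.
  apply: is_derive_bigsum => j; apply: is_deriveM.
    by apply: is_deriveZ; apply: is_derive_coord.
  exact: is_derive_coord.
rewrite -big_split; apply: eq_bigr => j _ /=.
by rewrite addrC; congr (_ + _); rewrite mulrC.
Qed.

Lemma derivable_bigsum (R : realType) (V : normedModType R) (I : Type)
    (s : seq I) (F : I -> V -> R) q v :
  (forall i, derivable (F i) q v) -> derivable (fun p => \sum_(i <- s) F i p) q v.
Proof.
move=> dF; elim: s => [|i s IHs].
  under eq_fun do rewrite big_nil; exact: derivable_cst.
under eq_fun do rewrite big_cons; exact: (derivableD (dF i) IHs).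
Qed.

Lemma derivable_bigprod (R : realType) (V : normedModType R) (I : Type)
    (s : seq I) (F : I -> V -> R) q v :
  (forall i, derivable (F i) q v) -> derivable (fun p => \prod_(i <- s) F i p) q v.
Proof.
move=> dF; elim: s => [|i s IHs].
  under eq_fun do rewrite big_nil; exact: derivable_cst.
under eq_fun do rewrite big_cons; exact: (derivableM (dF i) IHs).
Qed.

Lemma derivable_det (R : realType) (V : normedModType R) n
    (F : V -> 'M[R]_n) q v :
  (forall i j, derivable (fun p => F p i j) q v) ->
  derivable (fun p => \det (F p)) q v.
Proof.
move=> dF; apply: derivable_bigsum => s; apply: derivableM.
  exact: derivable_cst.
exact: derivable_bigprod.
Qed.

(** By Cramer's formula; the determinant must not vanish near [q], because
    [invmx] is the identity on singular matrices. *)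
Lemma derivable_invmx (R : realType) (V : normedModType R) n
    (F : V -> 'M[R]_n.+1) q v :
  (\forall p \near q, F p \in unitmx) -> derivable F q v ->
  derivable (fun p => invmx (F p)) q v.
Proof.
move=> Fu dF; have dFij := (derivable_mxP _ _ _).1 dF.
apply: (@near_eq_derivable _ _ _ (fun p => (\det (F p))^-1 *: \adj (F p))).
  by apply: filterS Fu => p Fp; rewrite /invmx Fp.
apply/derivable_mxP => i j.
have -> : (fun p => ((\det (F p))^-1 *: \adj (F p)) i j)
    = (fun p => (\det (F p))^-1)
      * ((fun=> (-1) ^+ (j + i)) * fun p => \det (row' j (col' i (F p)))).
  by apply/funext => p; rewrite !mxE.
apply: derivableM.
  apply: derivableV; last exact: derivable_det.
  by rewrite -unitfE -unitmxE; exact: nbhs_singleton Fu.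
apply: derivableM; first exact: derivable_cst.
apply: derivable_det => k l.
by under eq_fun do rewrite !mxE; exact: dFij.
Qed.

(** * Smooth maps on an open set of the plane *)

Lemma smooth_on_pd (R : realType) (V : normedModType R) (U : set 'rV[R]_2)
    (f : 'rV[R]_2 -> V) i : smooth_on U f -> smooth_on U (pd f i).
Proof.
move=> sf s q Uq; have := sf (rcons s i) q Uq.
by rewrite /iter_pd foldr_rcons.
Qed.

Lemma smooth_on_is_derive (R : realType) (V : normedModType R)
    (U : set 'rV[R]_2) (f : 'rV[R]_2 -> V) i q :
  smooth_on U f -> U q -> is_derive q (delta_mx 0 i) f (pd f i q).
Proof. by move=> sf Uq; apply: derivableP; apply: (sf [::] q Uq).2. Qed.

Lemma pdC (R : realType) m n (U : set 'rV[R]_2)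
    (f : 'rV[R]_2 -> 'M[R]_(m.+1, n.+1)) i j q :
  open U -> smooth_on U f -> U q -> pd (pd f i) j q = pd (pd f j) i q.
Proof.
move=> oU sf Uq; apply: (schwarz_matrix oU Uq).
- move=> p Up; split; [exact: (sf [::] p Up).2|exact: (sf [::] p Up).2| |].
    exact: (sf [:: i] p Up).2.
  exact: (sf [:: j] p Up).2.
- exact: (sf [:: j; i] q Uq).1.
- exact: (sf [:: i; j] q Uq).1.
Qed.

(** * Tangent and normal derivatives along a parametrized surface *)

Section Patch.
Variables (R : realType) (U : set 'rV[R]_2) (X : 'rV[R]_2 -> 'rV[R]_4).
Hypotheses (oU : open U) (sX : smooth_on U X).
Hypothesis spX : forall q, U q -> spacelike_at X q.

Let near_patch q : U q -> \forall p \near q, U p.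
Proof. by move=> Uq; apply: open_nbhs_nbhs. Qed.

Let gU q : U q -> induced_metric X q \in unitmx.
Proof. by move=> Uq; apply: induced_metric_unit; apply: spX. Qed.

Lemma induced_metric_sym q : (induced_metric X q)^T = induced_metric X q.
Proof. by apply/matrixP => i j; rewrite !mxE; apply: minkC. Qed.

Lemma mink_pd_tan q (a : 'rV[R]_2) i :
  mink (a *m jac X q) (pd X i q) = (a *m induced_metric X q) 0 i.
Proof.
rewrite mulmx_sum_row mink_suml mxE; apply: eq_bigr => j _.
by rewrite minkZl rowK mxE.
Qed.

Lemma normal_pd q v i : is_normal X q v -> mink v (pd X i q) = 0.
Proof. by move=> vN; have := vN (delta_mx 0 i); rewrite -rowE rowK. Qed.

Lemma tan_coord_metric q v : U q ->
  tan_coord X q v *m induced_metric X q = \row_i mink v (pd X i q).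
Proof. by move=> Uq; rewrite mulmxKV ?gU. Qed.

Lemma tan_coord_jac q a : U q -> tan_coord X q (a *m jac X q) = a.
Proof.
move=> Uq; rewrite -[RHS](mulmxK (gU Uq)); congr (_ *m _).
by apply/rowP => i; rewrite mxE mink_pd_tan.
Qed.

Lemma tan_coordD q v w : tan_coord X q (v + w) = tan_coord X q v + tan_coord X q w.
Proof.
by rewrite -mulmxDl; congr (_ *m _); apply/rowP => i; rewrite !mxE minkDl.
Qed.

Lemma tan_coordZ q c v : tan_coord X q (c *: v) = c *: tan_coord X q v.
Proof.
by rewrite scalemxAl; congr (_ *m _); apply/rowP => i; rewrite !mxE minkZl.
Qed.

Lemma tan_coord_sum q (I : finType) (F : I -> 'rV[R]_4) :
  tan_coord X q (\sum_i F i) = \sum_i tan_coord X q (F i).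
Proof.
apply: (big_morph (tan_coord X q)) => [u v|]; first exact: tan_coordD.
by rewrite -(scale0r 0) tan_coordZ scale0r.
Qed.

Lemma is_derive_pd i j q : U q ->
  is_derive q (delta_mx 0 i) (pd X j) (pd (pd X j) i q).
Proof. by move=> Uq; apply: (smooth_on_is_derive _ (smooth_on_pd j sX)). Qed.

Lemma is_derive_jac i q : U q ->
  is_derive q (delta_mx 0 i) (jac X) (\matrix_j pd (pd X j) i q).
Proof.
move=> Uq; apply: is_derive_matrix => j k.
have -> : (fun p => jac X p j k) = fun p => pd X j p 0 k.
  by apply/funext => p; rewrite mxE.
by rewrite mxE; apply: is_derive_coord; apply: is_derive_pd.
Qed.

Lemma is_derive_metric i j k q : U q ->
  is_derive q (delta_mx 0 k) (fun p => induced_metric X p i j)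
    (mink (pd (pd X i) k q) (pd X j q) + mink (pd X i q) (pd (pd X j) k q)).
Proof.
move=> Uq; have -> : (fun p => induced_metric X p i j)
    = fun p => mink (pd X i p) (pd X j p) by apply/funext => p; rewrite mxE.
by apply: is_derive_mink; apply: is_derive_pd.
Qed.

(** The Koszul formula: once the derivatives of the metric are expanded and mixed
    derivatives are identified, the six terms of a Christoffel symbol of the first
    kind cancel to twice the product of [d_i d_j X] with a coordinate vector. *)
Lemma nabla_coord_field i j q : U q ->
  nabla (induced_metric X) i (coord_field j) q
    = tan_coord X q (pd (pd X j) i q).
Proof.
move=> Uq; pose Y a := pd X a q; pose H a b := pd (pd X b) a q.
have HC a b : H a b = H b a by apply: (pdC b a oU sX Uq).
have pdg a b c : pd (fun p => induced_metric X p a b) c q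
    = mink (H c a) (Y b) + mink (Y a) (H c b).
  by case: (is_derive_metric a b c Uq).
have PC k l : invmx (induced_metric X q) k l = invmx (induced_metric X q) l k.
  by rewrite -[in LHS]induced_metric_sym -trmx_inv mxE.
rewrite /nabla /christoffel /tan_coord {1}/pd derive_cst add0r -/(H i j).
move: (invmx _) PC => P PC.
clearbody H; apply/rowP => k.
rewrite mxE (bigD1 j)//= [X in _ + X]big1 => [|l lj]; last first.
  by rewrite mxE (negPf lj) andbF mulr0.
rewrite mxE !eqxx mulr1 addr0 mulr_sumr mxE.
apply: eq_bigr => l _; rewrite !pdg mxE -/(Y l).
clearbody Y.
rewrite (HC j i) (HC l i) (HC l j) (PC k l) [mink (Y j) _]minkC.
by field.
Qed.

Lemma is_derive_tan i q (y : 'rV[R]_2 -> 'rV[R]_2) dy : U q ->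
  is_derive q (delta_mx 0 i) y dy ->
  is_derive q (delta_mx 0 i) (fun p => y p *m jac X p)
    (dy *m jac X q + \sum_j y q 0 j *: pd (pd X j) i q).
Proof.
move=> Uq yP; have -> : \sum_j y q 0 j *: pd (pd X j) i q
    = y q *m \matrix_j pd (pd X j) i q.
  by rewrite mulmx_sum_row; apply: eq_bigr => j _; rewrite rowK.
by apply: is_derive_mulmx => //; apply: is_derive_jac.
Qed.

(** By the product rule, the ambient derivative of [y *m jac X] consists of a
    tangent vector, whose coordinates are the derivatives of [y], and of second
    derivatives of [X], whose tangent parts are the Christoffel terms. *)
Lemma nabla_tan i q (y : 'rV[R]_2 -> 'rV[R]_2) : U q ->
  derivable y q (delta_mx 0 i) ->
  nabla (induced_metric X) i y q
    = tan_coord X q (pd (fun p => y p *m jac X p) i q).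
Proof.
move=> Uq /derivableP yP.
rewrite {1}/pd; have [_ ->] := is_derive_tan Uq yP.
rewrite tan_coordD tan_coord_jac// tan_coord_sum; congr (_ + _).
apply/rowP => k; rewrite mxE summxE; apply: eq_bigr => j _.
rewrite tan_coordZ -nabla_coord_field// mxE mulrC; congr (_ * _).
rewrite /nabla /pd derive_cst add0r mxE (bigD1 j)//= [X in _ + X]big1 => [|l lj].
  by rewrite mxE !eqxx mulr1 addr0.
by rewrite mxE (negPf lj) andbF mulr0.
Qed.

Lemma sff_coordE i j q : U q ->
  sff_coord X q i j = normal_part X q (pd (pd X j) i q).
Proof. by move=> Uq; rewrite /sff_coord nabla_coord_field. Qed.

Lemma sff_coord_normal i j q : U q -> is_normal X q (sff_coord X q i j).
Proof. by move=> Uq; rewrite sff_coordE//; apply: normal_partP; apply: spX. Qed.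

Lemma sff_coordC i j q : U q -> sff_coord X q i j = sff_coord X q j i.
Proof.
move=> Uq; rewrite (sff_coordE i j Uq) (sff_coordE j i Uq).
exact: (congr1 _ (pdC j i oU sX Uq)).
Qed.

Lemma derivable_tan_coord i q (F : 'rV[R]_2 -> 'rV[R]_4) : U q ->
  derivable F q (delta_mx 0 i) ->
  derivable (fun p => tan_coord X p (F p)) q (delta_mx 0 i).
Proof.
move=> Uq dF.
have dg : derivable (induced_metric X) q (delta_mx 0 i).
  apply/derivable_mxP => k l.
  by case: (is_derive_metric k l i Uq).
have dP : derivable (fun p => invmx (induced_metric X p)) q (delta_mx 0 i).
  apply: derivable_invmx dg.
  by apply: filterS (near_patch Uq) => p; apply: gU.
have dr : derivable (fun p => \row_j mink (F p) (pd X j p) : 'rV[R]_2) q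
    (delta_mx 0 i).
  apply/derivable_mxP => k l.
  under eq_fun do rewrite mxE.
  by case: (is_derive_mink (derivableP dF) (is_derive_pd i l Uq)).
by case: (is_derive_mulmx (derivableP dr) (derivableP dP)).
Qed.

Lemma derivable_tan_part i q (F : 'rV[R]_2 -> 'rV[R]_4) : U q ->
  derivable F q (delta_mx 0 i) ->
  derivable (fun p => tan_part X p (F p)) q (delta_mx 0 i).
Proof.
move=> Uq dF.
by case: (is_derive_tan Uq (derivableP (derivable_tan_coord Uq dF))).
Qed.

Lemma is_derive_pd2 i j k q : U q ->
  is_derive q (delta_mx 0 i) (pd (pd X k) j) (pd (pd (pd X k) j) i q).
Proof.
by move=> Uq; apply: (smooth_on_is_derive _ (smooth_on_pd j (smooth_on_pd k sX))).
Qed.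

Lemma mink_sff i j q v : U q -> is_normal X q v ->
  mink (sff_coord X q i j) v = mink (pd (pd X j) i q) v.
Proof.
move=> Uq vN; rewrite (sff_coordE i j Uq) minkDl minkNl.
by rewrite [mink (tan_part _ _ _) v]minkC vN subr0.
Qed.

(** The tangent field [nabla_i d_k] is [d_i d_k X] minus its normal part. The
    derivative of that normal part along [d_a] is controlled, against [d_l X], by
    differentiating the orthogonality of the two fields; this is where the
    product of second fundamental forms comes from. *)
Lemma nabla2_coord_field a i k l q : U q ->
  (nabla (induced_metric X) a (nabla (induced_metric X) i (coord_field k)) q
     *m induced_metric X q) 0 l
  = mink (pd (pd (pd X k) i) a q) (pd X l q)
    + mink (sff_coord X q i k) (sff_coord X q a l).
Proof.
move=> Uq; set y := nabla _ i _; pose x := pd (pd X k) i.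
have yE : \forall p \near q, tan_coord X p (x p) = y p.
  apply: filterS (near_patch Uq) => p Up.
  exact: (esym (nabla_coord_field i k Up)).
have dx := is_derive_pd2 a i k Uq.
have [dx1 _] := dx.
have dy := near_eq_derivable yE (derivable_tan_coord Uq dx1).
have dT := derivableP (derivable_tan_part Uq dx1).
have dN : is_derive q (delta_mx 0 a) (fun p => normal_part X p (x p))
    (pd x a q - pd (fun p => tan_part X p (x p)) a q).
  exact: (is_deriveB dx dT).
have N0 : mink (pd x a q - pd (fun p => tan_part X p (x p)) a q) (pd X l q)
    + mink (normal_part X q (x q)) (pd (pd X l) a q) = 0.
  have [_ <-] := is_derive_mink dN (is_derive_pd a l Uq).
  rewrite -[RHS](derive_cst (0 : R) q (delta_mx 0 a)); apply: near_eq_derive.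
  apply: filterS (near_patch Uq) => p Up.
  exact: (normal_pd l (normal_partP _ (spX Up))).
rewrite (nabla_tan Uq dy).
have -> : pd (fun p => y p *m jac X p) a q = pd (fun p => tan_part X p (x p)) a q.
  apply: near_eq_derive; apply: filterS yE => p yp.
  by rewrite /tan_part yp.
rewrite (tan_coord_metric _ Uq) mxE minkC.
rewrite [X in _ + X]minkC (mink_sff a l Uq (sff_coord_normal i k Uq)).
rewrite [X in _ + X]minkC (sff_coordE i k Uq).
move: N0; rewrite minkDl minkNl [X in _ = _ -> X = _]minkC.
by move/eqP; rewrite addrAC subr_eq0 => /eqP <-.
Qed.

(** The third derivatives of [X] in [nabla2_coord_field] cancel by symmetry. *)
Lemma gauss_equation k l q : U q ->
  (riemann (induced_metric X) (coord_field k) q *m induced_metric X q) 0 l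
  = mink (sff_coord X q 1 k) (sff_coord X q 0 l)
    - mink (sff_coord X q 0 k) (sff_coord X q 1 l).
Proof.
move=> Uq; have arith (a b c : R) : (a + b) - (a + c) = b - c.
  by rewrite opprD addrACA subrr add0r.
have third := pdC 1 0 oU (smooth_on_pd k sX) Uq.
have E0 := nabla2_coord_field 0 1 k l Uq.
have E1 := nabla2_coord_field 1 0 k l Uq.
have E1' := etrans E1 (congr1 (fun v => mink v _ + _) (esym third)).
rewrite /riemann mulmxBl mxE [X in _ + X]mxE.
apply: (etrans (congr2 (fun a b => a - b) E0 E1')).
exact: arith.
Qed.

(** Differentiate [<N, N> = 0] for [N = Z - T]: as [Z] is constant, what remains is
    the product of [N] with the derivative of the tangent field [T], whose normal
    part is [B(d_k, T)]. *)
Lemma sff_tan_coord_null Z k q : U q ->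
  (forall p, U p -> mink (normal_part X p Z) (normal_part X p Z) = 0) ->
  \sum_j tan_coord X q Z 0 j * mink (sff_coord X q k j) (normal_part X q Z) = 0.
Proof.
move=> Uq nn.
have dz := derivable_tan_coord Uq (derivable_cst Z q (delta_mx 0 k)).
have dT := is_derive_tan Uq (derivableP dz).
have dN := is_deriveB (is_derive_cst Z q (delta_mx 0 k)) dT.
have NN := normal_partP Z (spX Uq).
have [_] := is_derive_mink dN dN.
rewrite (_ : 'D__ _ q = 0); last first.
  rewrite -[RHS](derive_cst (0 : R) q (delta_mx 0 k)); apply: near_eq_derive.
  by apply: filterS (near_patch Uq) => p Up; exact: nn.
rewrite [X in _ + X]minkC -mulr2n => /esym/eqP; rewrite mulrn_eq0/= sub0r.
rewrite minkNl oppr_eq0 minkDl minkC NN add0r mink_suml => /eqP dN0.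
rewrite -[RHS]dN0; apply: eq_bigr => j _.
by rewrite (mink_sff k j Uq NN) minkZl.
Qed.

End Patch.

(** * Linear algebra of the tangent and normal planes *)

(** In a [g]-orthonormal basis whose first vector is [z], the only entry of [h]
    that can be nonzero is the last diagonal one, and it equals the trace. Over a
    general field there need not be such a basis; instead, each diagonal entry of
    [h] is multiplied by [g(z, z) = 1] and rewritten as a combination of the trace
    and of the entries of [h z]. *)
Lemma traceless_degenerate_eq0 (F : fieldType) (g h : 'M[F]_2) (z : 'rV[F]_2) :
  g^T = g -> h^T = h -> g \in unitmx -> (z *m g *m z^T) 0 0 = 1 ->
  h *m z^T = 0 -> \sum_i \sum_j invmx g i j * h i j = 0 -> h = 0.
Proof.
move=> gT hT gU zz hz tr.
have g10 : g 1 0 = g 0 1 by rewrite -[in LHS]gT mxE.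
have h10 : h 1 0 = h 0 1 by rewrite -[in LHS]hT mxE.
have sum2 (f : 'I_2 -> F) : \sum_i f i = f 0 + f 1.
  by rewrite !big_ord_recl big_ord0 addr0; congr (_ + f _); apply/val_inj.
have hz0 : h 0 0 * z 0 0 + h 0 1 * z 0 1 = 0.
  by have /matrixP/(_ 0 0) := hz; rewrite !mxE sum2 ![z^T _ _]mxE.
have hz1 : h 0 1 * z 0 0 + h 1 1 * z 0 1 = 0.
  by have /matrixP/(_ 1 0) := hz; rewrite !mxE sum2 ![z^T _ _]mxE h10.
have {}zz : g 0 0 * z 0 0 ^+ 2 + 2 * g 0 1 * z 0 0 * z 0 1 + g 1 1 * z 0 1 ^+ 2 = 1.
  by rewrite -[RHS]zz !mxE !sum2 ![z^T _ _]mxE !mxE !sum2 g10; ring.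
have Pg i j : invmx g i 0 * g 0 j + invmx g i 1 * g 1 j = (i == j)%:R.
  by have /matrixP/(_ i j) := mulVmx gU; rewrite !mxE sum2.
move: tr; rewrite !sum2 h10 => tr.
(* The trace multiplied by [\det g], with the adjugate in place of the inverse. *)
have adj_trace : g 1 1 * h 0 0 - 2 * g 0 1 * h 0 1 + g 0 0 * h 1 1 = 0.
  pose d := g 0 0 * g 1 1 - g 0 1 ^+ 2; pose P := invmx g.
  have P00 : P 0 0 * g 0 0 + P 0 1 * g 0 1 = 1 by have := Pg 0 0; rewrite g10.
  have P01 : P 0 0 * g 0 1 + P 0 1 * g 1 1 = 0 by have := Pg 0 1.
  have P10 : P 1 0 * g 0 0 + P 1 1 * g 0 1 = 0 by have := Pg 1 0; rewrite g10.
  have P11 : P 1 0 * g 0 1 + P 1 1 * g 1 1 = 1 by have := Pg 1 1.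
  have d00 : g 1 1 = d * P 0 0.
    transitivity (g 1 1 * (P 0 0 * g 0 0 + P 0 1 * g 0 1)
      - g 0 1 * (P 0 0 * g 0 1 + P 0 1 * g 1 1)); last by rewrite /d; ring.
    by rewrite P00 P01 mulr1 mulr0 subr0.
  have d01 : - g 0 1 = d * P 0 1.
    transitivity (g 0 0 * (P 0 0 * g 0 1 + P 0 1 * g 1 1)
      - g 0 1 * (P 0 0 * g 0 0 + P 0 1 * g 0 1)); last by rewrite /d; ring.
    by rewrite P00 P01 mulr1 mulr0 sub0r.
  have d10 : - g 0 1 = d * P 1 0.
    transitivity (g 1 1 * (P 1 0 * g 0 0 + P 1 1 * g 0 1)
      - g 0 1 * (P 1 0 * g 0 1 + P 1 1 * g 1 1)); last by rewrite /d; ring.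
    by rewrite P10 P11 mulr1 mulr0 sub0r.
  have d11 : g 0 0 = d * P 1 1.
    transitivity (g 0 0 * (P 1 0 * g 0 1 + P 1 1 * g 1 1)
      - g 0 1 * (P 1 0 * g 0 0 + P 1 1 * g 0 1)); last by rewrite /d; ring.
    by rewrite P10 P11 mulr1 mulr0 subr0.
  transitivity (g 1 1 * h 0 0 + (- g 0 1 * h 0 1 + - g 0 1 * h 0 1)
    + g 0 0 * h 1 1); first by ring.
  rewrite {1}d01 d10 {1}d00 {1}d11 -[RHS](mulr0 d) -tr -/P; ring.
have h00 : h 0 0 = 0.
  rewrite -[LHS]mulr1 -zz.
  have -> : h 0 0 * (g 0 0 * z 0 0 ^+ 2 + 2 * g 0 1 * z 0 0 * z 0 1
      + g 1 1 * z 0 1 ^+ 2)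
    = z 0 1 ^+ 2 * (g 1 1 * h 0 0 - 2 * g 0 1 * h 0 1 + g 0 0 * h 1 1)
      + (g 0 0 * z 0 0 + 2 * g 0 1 * z 0 1) * (h 0 0 * z 0 0 + h 0 1 * z 0 1)
      - g 0 0 * z 0 1 * (h 0 1 * z 0 0 + h 1 1 * z 0 1) by ring.
  by rewrite adj_trace hz0 hz1 !mulr0 addr0 subr0.
have h11 : h 1 1 = 0.
  rewrite -[LHS]mulr1 -zz.
  have -> : h 1 1 * (g 0 0 * z 0 0 ^+ 2 + 2 * g 0 1 * z 0 0 * z 0 1
      + g 1 1 * z 0 1 ^+ 2)
    = z 0 0 ^+ 2 * (g 1 1 * h 0 0 - 2 * g 0 1 * h 0 1 + g 0 0 * h 1 1)
      + (g 1 1 * z 0 1 + 2 * g 0 1 * z 0 0) * (h 0 1 * z 0 0 + h 1 1 * z 0 1)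
      - g 1 1 * z 0 0 * (h 0 0 * z 0 0 + h 0 1 * z 0 1) by ring.
  by rewrite adj_trace hz0 hz1 !mulr0 addr0 subr0.
have h01 : h 0 1 = 0.
  apply/eqP/negP => /negP h01; move: hz0 hz1; rewrite h00 h11 !mul0r add0r addr0.
  move=> /eqP; rewrite mulf_eq0 (negPf h01)/= => /eqP z1.
  move=> /eqP; rewrite mulf_eq0 (negPf h01)/= => /eqP z0.
  move: zz; rewrite z0 z1 !expr0n/= !mulr0 !addr0 => /eqP.
  by rewrite eq_sym oner_eq0.
apply/matrixP => i j; rewrite [RHS]mxE.
have ord2 (k : 'I_2) : k = 0 \/ k = 1.
  by case: k => [[|[|//]] k2]; [left|right]; apply/val_inj.
by case: (ord2 i) => ->; case: (ord2 j) => ->; rewrite ?h10.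
Qed.

Lemma mink_tan_part_self (R : realType) (X : 'rV[R]_2 -> 'rV[R]_4) q v :
  spacelike_at X q -> mink (tan_part X q v) (tan_part X q v)
    = mink v v - mink (normal_part X q v) (normal_part X q v).
Proof.
move=> spX; have NN a := normal_partP v spX a.
have vE : v = normal_part X q v + tan_part X q v by rewrite subrK.
have NT : mink (normal_part X q v) (tan_part X q v) = 0 := NN _.
move: vE NT; move: (normal_part _ _ _) (tan_part _ _ _) => n t -> nt.
by rewrite !(minkDl, minkDr) [mink t n]minkC nt; ring.
Qed.

Section Frame.
Variables (R : realType) (X : 'rV[R]_2 -> 'rV[R]_4) (q : 'rV[R]_2).
Variables (Z : 'rV[R]_4) (w : 'rV[R]_2) (w' : 'rV[R]_4).
Hypotheses (spX : spacelike_at X q) (nn : lightlike (normal_part X q Z)).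
Hypothesis fr : adapted_frame X q Z w w'.

(** The difference of the two sides is orthogonal to the tangent plane, to [N] and
    to [W'], hence to the four vectors of the adapted frame, which form a basis
    because their determinant is positive. *)
Lemma normal_orth_null v : is_normal X q v -> mink v (normal_part X q Z) = 0 ->
  v = mink v w' *: normal_part X q Z.
Proof.
move=> vN vn; set n := normal_part X q Z in vn *.
have NN : is_normal X q n := normal_partP Z spX.
have [_ nn0] := nn; have nw := af_dual fr; have wN := af_normal fr.
apply/eqP; rewrite -subr_eq0; set u := v - _; apply/eqP.
have uT a : mink u (a *m jac X q) = 0.
  by rewrite minkDl minkNl minkZl vN NN mulr0 subr0.
have un : mink u n = 0 by rewrite minkDl minkNl minkZl vn nn0 mulr0 subr0.
have uw : mink u w' = 0 by rewrite minkDl minkNl minkZl nw mulr1 subrr.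
have := af_oriented fr; set F := \matrix_(i < 4) _ => detF.
have FU : F^T \in unitmx by rewrite unitmx_tr unitmxE unitfE gt_eqF.
have uF : u *m mink_mx *m F^T = 0.
  apply/rowP => i; rewrite [RHS]mxE.
  have -> : (u *m mink_mx *m F^T) 0 i = mink u (row i F).
    rewrite minkE !mxE; apply: eq_bigr => k _.
    by congr (_ * _); rewrite !mxE.
  rewrite rowK; case: i => [[|[|[|[|//]]]] i4] /=; rewrite ?uT//.
  - by rewrite minkZr minkDr un uw addr0 mulr0.
  - by rewrite minkZr minkDr minkNr un uw subr0 mulr0.
have /rowP u0 : u *m mink_mx = 0 by rewrite -[LHS](mulmxK FU) uF mul0mx.
apply/rowP => i; have /eqP := u0 i.
by rewrite mul_mx_diag !mxE mulf_eq0 signr_eq0 orbF => /eqP.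
Qed.

Lemma shape_opN nu a : shape_op X q nu (- a) = - shape_op X q nu a.
Proof.
rewrite /shape_op -mulNmx; congr (_ *m _); apply/rowP => j.
rewrite !mxE -minkNl; congr mink; rewrite /second_ff.
rewrite -sumrN; apply: eq_bigr => i _.
rewrite -sumrN; apply: eq_bigr => k _.
by rewrite mxE mulNr scaleNr.
Qed.

(** As [<B, N> = 0], the shape operator of [N] vanishes, and those of [e_3] and
    [e_4] are both multiples of the one of [W'], with opposite coefficients. *)
Lemma normal_curvature_eq0 :
  (forall i j, mink (sff_coord X q i j) (normal_part X q Z) = 0) ->
  normal_curvature X q Z w w' = 0.
Proof.
rewrite /normal_curvature; move: (normal_part X q Z) => n Bn.
have A43 a : shape_op X q (frame4 n w') a
    = - shape_op X q (frame3 n w') a.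
  rewrite /shape_op -mulNmx; congr (_ *m _); apply/rowP => j.
  have Bn' : mink (second_ff X q a (delta_mx 0 j)) n = 0.
    rewrite mink_suml big1// => i _; rewrite mink_suml big1// => k _.
    by rewrite minkZl Bn mulr0.
  by rewrite !mxE !minkZr !minkDr minkNr Bn' !add0r mulrN.
by rewrite !A43 shape_opN subrr mul0mx -(scale0r (0 : 'rV[R]_4)) minkZl mul0r.
Qed.
End Frame.

Theorem proposition1p15 (R : realType) (M : set 'rV[R]_4) (Z : 'rV[R]_4)
    (M_surface : smooth_surface M)
    (M_spacelike : spacelike M)
    (Z_unit : mink Z Z = 1)
    (Z_null : canonical_normal_null_direction M Z)
    (M_minimal : minimal M) :
  flat M /\ flat_normal_bundle M Z.
Proof.
have Bn U X q : local_param M U X -> U q ->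
    forall i j, mink (sff_coord X q i j) (normal_part X q Z) = 0.
  move=> lpX Uq; have oU := lp_open lpX; have sX := lp_smooth lpX.
  have spX p (Up : U p) : spacelike_at X p := M_spacelike _ _ _ lpX Up.
  have NN := normal_partP Z (spX _ Uq).
  pose h := \matrix_(i, j) mink (sff_coord X q i j) (normal_part X q Z).
  suff h0 : h = 0 by move=> i j; have /matrixP/(_ i j) := h0; rewrite !mxE.
  apply: (@traceless_degenerate_eq0 _ (induced_metric X q) h (tan_coord X q Z)).
  - exact: induced_metric_sym.
  - apply/matrixP => i j; rewrite !mxE.
    by rewrite (sff_coordC oU sX j i Uq).
  - exact: induced_metric_unit (spX _ Uq).
  - rewrite -mink_tan -/(tan_part X q Z).
    by rewrite mink_tan_part_self ?(Z_null _ _ _ lpX Uq).2 ?subr0//; exact: spX.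
  - apply/matrixP => k l; rewrite !mxE.
    have nn p (Up : U p) := (Z_null _ _ _ lpX Up).2.
    rewrite -[RHS](sff_tan_coord_null oU sX spX k Uq nn).
    by apply: eq_bigr => j _; rewrite !mxE mulrC (ord1 l).
  - have := M_minimal _ _ _ lpX Uq; rewrite /mean_curvature_vector => /eqP.
    rewrite scaler_eq0 invr_eq0 pnatr_eq0 /= => /eqP H0.
    transitivity (mink (0 : 'rV[R]_4) (normal_part X q Z)).
      rewrite -[in RHS]H0 mink_suml; apply: eq_bigr => i _.
      by rewrite mink_suml; apply: eq_bigr => j _; rewrite minkZl mxE.
    by rewrite -(scale0r (0 : 'rV[R]_4)) minkZl mul0r.
split=> U X q lpX Uq; have oU := lp_open lpX; have sX := lp_smooth lpX;
  have spX p (Up : U p) : spacelike_at X p := M_spacelike _ _ _ lpX Up.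
  have nn := Z_null _ _ _ lpX Uq.
  have [w [w' fr]] := adapted_frame_exists (spX _ Uq) Z_unit nn.
  have BE i j := normal_orth_null (spX _ Uq) nn fr
    (sff_coord_normal oU sX spX i j Uq) (Bn _ _ _ lpX Uq i j).
  have BB i j k l : mink (sff_coord X q i j) (sff_coord X q k l) = 0.
    by rewrite BE [sff_coord X q k l]BE minkZl minkZr nn.2 !mulr0.
  have K0 : mink (sff_coord X q 1 1) (sff_coord X q 0 0)
      - mink (sff_coord X q 0 1) (sff_coord X q 1 0) = 0.
    exact: etrans (congr2 (fun a b => a - b) (BB 1 1 0 0) (BB 0 1 1 0)) (subrr 0).
  rewrite /gauss_curvature (etrans (gauss_equation oU sX spX 1 0 Uq) K0).
  exact: mul0r.
by move=> w w' _; apply: normal_curvature_eq0; exact: Bn lpX Uq.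
Qed.
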